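(* Let $G$ be a compact Hausdorff topological group, $H$ a closed translation invariant subspace of $C(G)$, $Y$ a metric space, $1\le p<\infty$, and $u: H\to Y$ a Lipschitz $p$-$B_{H^*}$-summing translation invariant map. Then the normalized Haar measure $\sigma_G$ on $G$ is a Pietsch measure for $u$; that is, there is a constant $C>0$ such that for all $T,S\in H$, $$d_Y(u(T),u(S)) \le C\left(\int_G |T(\varphi)-S(\varphi)|^p\, d\sigma_G(\varphi)\right)^{1/p}.$$
   Context: $\mathbb{K}=\mathbb{R}$ or $\mathbb{C}$, and $C(G)$ is the Banach space of continuous functions $G\to\mathbb{K}$ with the sup norm. For $\psi\in G$, $I_\psi:G\to G$ is the left translation $I_\psi(\varphi)=\psi\varphi$. A nonempty subset $H\subseteq C(G)$ is translation invariant if $T\circ I_\psi\in H$ for all $T\in H$, $\psi\in G$; a map $u:H\to Y$ is translation invariant if $u(T\circ I_\psi)=u(T)$ for all $T\in H$, $\psi\in G$. The normalized Haar measure $\sigma_G$ is the unique Radon measure on $G$ with $\sigma_G(G)=1$ and $\sigma_G(\psi B)=\sigma_G(B)$ for every $\psi\in G$ and every Borel set $B\subseteq G$. $B_{H^*}$ is the closed unit ball of the dual Banach space $H^*$. A Lipschitz mapping $u:H\to Y$ is Lipschitz $p$-$B_{H^*}$-summing if there is a constant $C>0$ such that for all $n\in\mathbb{N}$ and all $x_1,\dots,x_n,q_1,\dots,q_n\in H$, $$\left(\sum_{j=1}^n d_Y(u(x_j),u(q_j))^p\right)^{1/p}\le C\sup_{f\in B_{H^*}}\left(\sum_{j=1}^n|f(x_j)-f(q_j)|^p\right)^{1/p}.$$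 A regular Borel probability measure $\nu$ on $G$ is a Pietsch measure for such a $u$ if there is $C>0$ with $d_Y(u(T),u(S)) \le C\left(\int_G |T(\varphi)-S(\varphi)|^p\, d\nu(\varphi)\right)^{1/p}$ for all $T,S\in H$. *)

(* Defs.v *)
From HB Require Import structures.
From mathcomp Require Import all_boot all_order all_algebra.
From mathcomp Require Import complex.
From mathcomp Require Import all_classical all_reals all_analysis.

Set Implicit Arguments.
Unset Strict Implicit.
Unset Printing Implicit Defensive.

Import Order.TTheory GRing.Theory Num.Theory.
Import numFieldNormedType.Exports.

Local Open Scope classical_set_scope.
Local Open Scope ring_scope.

(* The distinguished point carries no information (a group is inhabited by 1);
   it is there because measurable types are pointed in the library. *)
HB.mixin Record isTopologicalGroup G & PointedTopological G & Group G := {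
  mulg_continuous : continuous (fun z : G * G => (z.1 * z.2)%g) ;
  invg_continuous : continuous (fun x : G => (x^-1)%g) ;
}.

#[short(type="topologicalGroupType")]
HB.structure Definition TopologicalGroup :=
  {G of PointedTopological G & Group G & isTopologicalGroup G}.

HB.mixin Record isCompactHausdorff G & Topological G := {
  compact_setT : compact [set: G] ;
  hausdorff_setT : hausdorff_space G ;
}.

#[short(type="compactGroupType")]
HB.structure Definition CompactGroup :=
  {G of TopologicalGroup G & isCompactHausdorff G}.

Section left_translation.
Context {G : topologicalGroupType}.

Definition left_translation (psi : G) : G -> G := fun phi => (psi * phi)%g.

Fact left_translation_continuous psi : continuous (left_translation psi).
Proof.
move=> x; apply: (@continuous_comp _ _ _ (fun y => (psi, y))
  (fun z : G * G => (z.1 * z.2)%g)); last exact: mulg_continuous.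
by apply: cvg_pair => /=; [exact: cvg_cst|exact: cvg_id].
Qed.

HB.instance Definition _ psi :=
  isContinuous.Build G G (left_translation psi)
    (@left_translation_continuous psi).

End left_translation.

Variant scalar_kind := RealScalars | ComplexScalars.

Definition scalars (R : realType) (k : scalar_kind) : numFieldType :=
  match k with RealScalars => R | ComplexScalars => R[i] end.

(* The norm of a numFieldType takes its values in the field itself; the modulus
   is the same quantity as an element of R. *)
Definition modulus (R : realType) (k : scalar_kind) : scalars R k -> R :=
  match k with
  | RealScalars => fun x : R => `|x|
  | ComplexScalars => fun z : R[i] => complex.Re `|z|
  end.

Definition of_real (R : realType) (k : scalar_kind) : R -> scalars R k :=
  match k with
  | RealScalars => fun r : R => r
  | ComplexScalars => fun r : R => real_complex R r
  end.
Arguments of_real {R k} r.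

Section modulus_theory.
Context {R : realType} {k : scalar_kind}.
Implicit Types (x y : scalars R k) (r s : R).

Lemma of_real_modulus x : of_real (modulus x) = `|x|.
Proof.
by case: k x.
Qed.

Lemma ler_of_real r s : (of_real r <= of_real s :> scalars R k) = (r <= s).
Proof. by case: k => //=; rewrite lecR. Qed.

Lemma ltr_of_real r s : (of_real r < of_real s :> scalars R k) = (r < s).
Proof. by case: k => //=; rewrite ltcR. Qed.

Lemma of_realD r s : of_real (r + s) = of_real r + of_real s :> scalars R k.
Proof. by case: k => //=; rewrite rmorphD. Qed.

Lemma of_realM r s : of_real (r * s) = of_real r * of_real s :> scalars R k.
Proof. by case: k => //=; rewrite rmorphM. Qed.

Lemma of_real0 : of_real 0 = 0 :> scalars R k.
Proof. by case: k. Qed.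

Lemma of_real_inj : injective (@of_real R k).
Proof.
by move=> r s rs; apply: le_anti; rewrite -!ler_of_real rs lexx.
Qed.

Lemma modulus_ge0 x : 0 <= modulus x.
Proof. by rewrite -ler_of_real of_real0 of_real_modulus. Qed.

Lemma modulusD x y : modulus (x + y) <= modulus x + modulus y.
Proof. by rewrite -ler_of_real of_realD !of_real_modulus ler_normD. Qed.

Lemma modulusM x y : modulus (x * y) = modulus x * modulus y.
Proof. by apply: of_real_inj; rewrite of_realM !of_real_modulus normrM. Qed.

Lemma modulus_eq0 x : modulus x = 0 -> x = 0.
Proof.
by move=> x0; apply/eqP; rewrite -normr_eq0 -of_real_modulus x0 of_real0.
Qed.

Lemma modulus_continuous : continuous (@modulus R k).
Proof.
move=> x; apply/(@cvgrPdist_lt _ _ _ (nbhs x) (nbhs_filter x)) => e e0.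
have e0' : 0 < of_real e :> scalars R k by rewrite -of_real0 ltr_of_real.
have dist y z : modulus y - modulus z <= modulus (y - z).
  by rewrite lerBlDr -{1}(subrK z y) modulusD.
have modN y : modulus (- y) = modulus y.
  by apply: of_real_inj; rewrite !of_real_modulus normrN.
have : nbhs x (ball x (of_real e)) by exact: nbhsx_ballx.
apply: (@filterS _ (nbhs x)) => y.
rewrite -ball_normE /ball_ /= -of_real_modulus ltr_of_real.
apply: le_lt_trans; rewrite ler_norml dist andbT lerNl opprB.
by rewrite -[leRHS]modN opprB dist.
Qed.

End modulus_theory.

Definition Cfun (R : realType) (k : scalar_kind) (G : compactGroupType) :
    Type :=
  continuousType G (scalars R k).

Section continuous_functions.
Context {R : realType} {k : scalar_kind} {G : compactGroupType}.
Local Notation K := (scalars R k).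
Local Notation CG := (@Cfun R k G).
Implicit Types T S : CG.

Definition Cfun_fun (T : CG) : G -> K := Continuous.sort T.
Coercion Cfun_fun : Cfun >-> Funclass.

HB.instance Definition _ := gen_eqMixin CG.
HB.instance Definition _ := gen_choiceMixin CG.

Lemma CfunP T S : (forall x, T x = S x) -> T = S.
Proof. by move=> TS; apply/continuousEP. Qed.

Lemma Cfun_continuous T : continuous (T : G -> K).
Proof. exact: cts_fun. Qed.

Fact Cfun_zero_subproof : continuous ((fun=> 0) : G -> K).
Proof. by move=> x; exact: cvg_cst. Qed.
Definition Cfun_zero : CG := mkcts Cfun_zero_subproof : continuousType G K.

Fact Cfun_add_subproof T S : continuous (fun x => T x + S x).
Proof. by move=> x; apply: cvgD; exact: Cfun_continuous. Qed.
Definition Cfun_add T S : CG :=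
  mkcts (@Cfun_add_subproof T S) : continuousType G K.

Fact Cfun_opp_subproof T : continuous (fun x => - T x).
Proof. by move=> x; apply: cvgN; exact: Cfun_continuous. Qed.
Definition Cfun_opp T : CG := mkcts (@Cfun_opp_subproof T) : continuousType G K.

Fact Cfun_scale_subproof (a : K) T : continuous (fun x => a * T x).
Proof. by move=> x; apply: cvgM; [exact: cvg_cst|exact: Cfun_continuous]. Qed.
Definition Cfun_scale (a : K) T : CG :=
  mkcts (@Cfun_scale_subproof a T) : continuousType G K.

Fact Cfun_addA : associative Cfun_add.
Proof. by move=> T S U; apply: CfunP => x; exact: addrA. Qed.
Fact Cfun_addC : commutative Cfun_add.
Proof. by move=> T S; apply: CfunP => x; exact: addrC. Qed.
Fact Cfun_add0 : left_id Cfun_zero Cfun_add.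
Proof. by move=> T; apply: CfunP => x; exact: add0r. Qed.
Fact Cfun_addN : left_inverse Cfun_zero Cfun_opp Cfun_add.
Proof. by move=> T; apply: CfunP => x; exact: addNr. Qed.

HB.instance Definition _ :=
  GRing.isZmodule.Build CG Cfun_addA Cfun_addC Cfun_add0 Cfun_addN.

Fact Cfun_scaleA a b T :
  Cfun_scale a (Cfun_scale b T) = Cfun_scale (a * b) T.
Proof. by apply: CfunP => x; exact: mulrA. Qed.
Fact Cfun_scale1 : left_id 1 Cfun_scale.
Proof. by move=> T; apply: CfunP => x; exact: mul1r. Qed.
Fact Cfun_scaleDr : right_distributive Cfun_scale +%R.
Proof. by move=> a T S; apply: CfunP => x; exact: mulrDr. Qed.
Fact Cfun_scaleDl T : {morph Cfun_scale^~ T : a b / a + b}.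
Proof. by move=> a b; apply: CfunP => x; exact: mulrDl. Qed.

HB.instance Definition _ :=
  GRing.Zmodule_isLmodule.Build K CG
    Cfun_scaleA Cfun_scale1 Cfun_scaleDr Cfun_scaleDl.

Definition sup_norm T : R := sup [set modulus (T x) | x in [set: G]].

Lemma has_sup_modulus T : has_sup [set modulus (T x) | x in [set: G]].
Proof.
apply: compact_has_sup; first by exists (modulus (T point)), point.
apply: continuous_compact; last exact: compact_setT.
apply: continuous_subspaceT => x.
by apply: continuous_comp; [exact: Cfun_continuous|exact: modulus_continuous].
Qed.

Lemma sup_norm_ub T x : modulus (T x) <= sup_norm T.
Proof. by apply: (sup_upper_bound (has_sup_modulus T)); exists x. Qed.

Lemma sup_norm_le T r : (forall x, modulus (T x) <= r) -> sup_norm T <= r.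
Proof.
by move=> Tr; apply: ge_sup => [|_ [x _ <-]//]; case: (has_sup_modulus T).
Qed.

Fact sup_normD T S :
  of_real (sup_norm (T + S)) <= of_real (sup_norm T) + of_real (sup_norm S)
    :> K.
Proof.
rewrite -of_realD ler_of_real; apply: sup_norm_le => x.
by apply: (le_trans (modulusD (T x) (S x))); rewrite lerD ?sup_norm_ub.
Qed.

Fact sup_normZ a T :
  of_real (sup_norm (a *: T)) = `|a| * of_real (sup_norm T) :> K.
Proof.
rewrite -of_real_modulus -of_realM; congr of_real; apply: le_anti.
apply/andP; split.
  apply: sup_norm_le => x; rewrite [leLHS]modulusM.
  by rewrite ler_wpM2l// ?modulus_ge0// sup_norm_ub.
have [->|a0] := eqVneq (modulus a) 0.
  by rewrite mul0r (le_trans _ (sup_norm_ub _ point))// modulus_ge0.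
have {}a0 : 0 < modulus a by rewrite lt_neqAle eq_sym a0 modulus_ge0.
rewrite mulrC -ler_pdivlMr//; apply: sup_norm_le => x.
by rewrite ler_pdivlMr// mulrC -modulusM (sup_norm_ub (a *: T) x).
Qed.

Fact sup_norm_eq0 T : of_real (sup_norm T) = 0 :> K -> T = 0.
Proof.
rewrite -of_real0 => /of_real_inj T0; apply: CfunP => x; apply: modulus_eq0.
by apply: le_anti; rewrite modulus_ge0 -T0 sup_norm_ub.
Qed.

(* `|T| is sup_norm T, embedded in K. *)
HB.instance Definition _ :=
  Lmodule_isNormed.Build K CG sup_normD sup_normZ sup_norm_eq0.

Definition translate (psi : G) T : CG :=
  (T : continuousType G K) \o left_translation psi : continuousType G K.

End continuous_functions.

(* Maps and functionals on a subset H of C(G) are total functions on C(G) that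
   are constrained on H only. *)
Section summing.
Context {R : realType} {k : scalar_kind} {G : compactGroupType}.
Local Notation K := (scalars R k).
Local Notation CG := (Cfun R k G).
Implicit Types (H : set CG) (f : CG -> K).

Definition subspace_of_Cfun H :=
  H 0 /\ forall (a : K) T S, H T -> H S -> H (a *: T + S).

Definition translation_invariant_set H :=
  forall T psi, H T -> H (translate psi T).

Definition translation_invariant_map (Y : Type) H (u : CG -> Y) :=
  forall T psi, H T -> u (translate psi T) = u T.

Definition dual_space H : set (CG -> K) :=
  [set f | (forall (a : K) T S, H T -> H S -> f (a *: T + S) = a * f T + f S) /\
           {within H, continuous f}].

Definition dual_norm H f : \bar R :=
  ereal_sup [set (modulus (f T))%:E | T in [set T | H T /\ `|T| <= 1]].

Definition dual_ball H : set (CG -> K) :=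
  [set f | dual_space H f /\ (dual_norm H f <= 1)%E].

Definition lipschitz_map (Y : metricType R) H (u : CG -> Y) :=
  exists L : R, forall T S, H T -> H S ->
    mdist (u T) (u S) <= L * sup_norm (T - S).

(* The supremum is taken in the extended reals, so it is never a default
   value. *)
Definition lipschitz_summing (p : R) (Y : metricType R) H (u : CG -> Y) :=
  lipschitz_map H u /\
  exists2 C : R, 0 < C & forall (n : nat) (x q : 'I_n -> CG),
    (forall j, H (x j)) -> (forall j, H (q j)) ->
    (((\sum_(j < n) mdist (u (x j)) (u (q j)) `^ p) `^ p^-1)%:E <=
     C%:E * ereal_sup
       [set ((\sum_(j < n) modulus (f (x j) - f (q j)) `^ p) `^ p^-1)%:E
         | f in dual_ball H])%E.

End summing.

Definition borel (G : compactGroupType) := g_sigma_algebraType (@open G).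

Section haar.
Context {R : realType} {G : compactGroupType}.
Implicit Type mu : {measure set (borel G) -> \bar R}.

(* On a compact Hausdorff space this is also what "finite Radon measure" means. *)
Definition regular_measure mu := forall B : set (borel G), measurable B ->
  mu B = ereal_sup [set mu A | A in [set A | @compact G A /\ A `<=` B]] /\
  mu B = ereal_inf [set mu U | U in [set U | @open G U /\ B `<=` U]].

Definition regular_borel_probability mu :=
  regular_measure mu /\ mu [set: borel G] = 1%E.

Definition normalized_haar_measure mu :=
  regular_borel_probability mu /\
  forall (psi : G) (B : set (borel G)), measurable B ->
    mu (left_translation psi @` B) = mu B.

Definition pietsch_measure (k : scalar_kind) (p : R) (Y : metricType R)
    (H : set (Cfun R k G)) (u : Cfun R k G -> Y) mu :=
  regular_borel_probability mu /\
  exists2 C : R, 0 < C & forall T S, H T -> H S ->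
    ((mdist (u T) (u S))%:E <=
     C%:E * (\int[mu]_phi (modulus (T phi - S phi) `^ p)%:E) `^ p^-1)%E.

End haar.

(* Main.v *)
(* Apply the summing inequality to translates T o I_psi_j, S o I_psi_j of a
   single pair: the left side is n d(u T, u S)^p, and by duality between l^p
   sums and linear functionals the right side is at most C^p times the maximum
   over x of sum_j h (psi_j x), where h = |T - S|^p. It remains to choose the
   psi_j, with repetitions, so that the averages of the h (psi_j x) are
   uniformly at most the Haar integral of h plus epsilon; Riemann sums of
   y |-> h (y^-1 x) do this. *)
Require Import Defs.
From HB Require Import structures.
From mathcomp Require Import all_boot all_order all_algebra.
From mathcomp Require Import all_classical all_reals all_analysis.
From mathcomp Require Import measurable_realfun ring lra.

Set Implicit Arguments.
Unset Strict Implicit.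
Unset Printing Implicit Defensive.

Import Order.TTheory GRing.Theory Num.Theory.
Import numFieldNormedType.Exports.

Local Open Scope classical_set_scope.
Local Open Scope ring_scope.

(** * Young's inequality and the modulus of scalars *)

(** Young's inequality for the exponents p and p / (p - 1), multiplied by p: this form contains no
    conjugate exponent, so it still makes sense at p = 1, where it reads s <= s. Unlike Hölder's
    inequality, it lets the duality argument below avoid dividing by a power of the sum to be
    bounded. *)
Lemma young_powR (R : realType) (p s t : R) : 1 <= p -> 0 <= s -> 0 <= t ->
  p * (s * t `^ (p - 1)) <= s `^ p + (p - 1) * t `^ p.
Proof.
rewrite le_eqVlt => /predU1P[<-|p1] s0 t0.
  by rewrite subrr powRr0 powRr1// mulr1 mul1r mul0r addr0.
have p0 : 0 < p by rewrite (lt_trans _ p1).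
have p10 : 0 < p - 1 by rewrite subr_gt0.
have pn0 : p != 0 by rewrite gt_eqF.
have p1n0 : p - 1 != 0 by rewrite gt_eqF.
have := @conjugate_powR _ s (t `^ (p - 1)) p (p / (p - 1)) s0 (powR_ge0 _ _) p0
  (divr_gt0 p0 p10).
have -> : p^-1 + (p / (p - 1))^-1 = 1.
  by rewrite invf_div -{1}[p^-1]mul1r -mulrDl addrC subrK divff.
rewrite -powRrM [(p - 1) * _]mulrC divfK// => /(_ erefl).
rewrite -(ler_pM2l p0) => /le_trans; apply.
rewrite le_eqVlt; apply/orP; left; apply/eqP; field.
by rewrite p1n0 pn0.
Qed.

Lemma modulus_of_real (R : realType) (k : scalar_kind) (r : R) :
  0 <= r -> modulus (of_real r : scalars R k) = r.
Proof.
move=> r0; apply: (@of_real_inj R k); rewrite of_real_modulus ger0_norm//.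
by rewrite -of_real0 ler_of_real.
Qed.

Lemma modulus0 (R : realType) (k : scalar_kind) :
  modulus (0 : scalars R k) = 0.
Proof. by rewrite -[in LHS]of_real0 modulus_of_real. Qed.

(** * From pointwise bounds on functions to bounds on functionals *)

Section dual_ball.
Context {R : realType} {k : scalar_kind} {G : compactGroupType}.
Local Notation CG := (Cfun R k G).
Context {H : set CG}.
Hypothesis H_subspace : subspace_of_Cfun H.

Lemma subspace_sum (I : Type) (s : seq I) (a : I -> scalars R k)
    (g : I -> CG) :
  (forall i, H (g i)) -> H (\sum_(i <- s) a i *: g i).
Proof.
move=> Hg; elim: s => [|i s ih]; first by rewrite big_nil; case: H_subspace.
by rewrite big_cons; apply H_subspace.
Qed.

Context {f : CG -> scalars R k}.
Hypothesis Hf : dual_ball H f.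

Lemma dual_ball0 : f 0 = 0.
Proof.
case: Hf => -[flin _] _; have [H0 _] := H_subspace.
by have := flin (-1) _ _ H0 H0; rewrite scaler0 addr0 mulN1r addNr.
Qed.

Lemma dual_ball_sum (I : Type) (s : seq I) (a : I -> scalars R k)
    (g : I -> CG) :
  (forall i, H (g i)) ->
  f (\sum_(i <- s) a i *: g i) = \sum_(i <- s) a i * f (g i).
Proof.
move=> Hg; elim: s => [|i s ih]; first by rewrite !big_nil dual_ball0.
rewrite !big_cons -ih; case: Hf => -[flin _] _.
by apply: flin => //; exact: subspace_sum.
Qed.

Lemma dual_ball_le (T : CG) : H T -> modulus (f T) <= sup_norm T.
Proof.
move=> HT; have [T0|Tn0] := eqVneq (sup_norm T) 0.
  have -> : T = 0 by apply: (@sup_norm_eq0 R k G); rewrite T0 of_real0.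
  rewrite dual_ball0 modulus0.
  by rewrite (le_trans _ (sup_norm_ub _ point))// modulus_ge0.
have N0 : 0 < sup_norm T.
  by rewrite lt_def Tn0 (le_trans _ (sup_norm_ub _ point))// modulus_ge0.
have NV0 : 0 <= (sup_norm T)^-1 by rewrite invr_ge0 ltW.
(* The dual norm tests [f] on the unit ball only, so [T] is rescaled to norm 1. *)
pose a : scalars R k := of_real (sup_norm T)^-1.
have [H0 Hlin] := H_subspace.
have HaT : H (a *: T) by rewrite -[a *: T]addr0; exact: Hlin.
have faT : f (a *: T) = a * f T.
  by case: Hf => -[flin _] _; rewrite -[a *: T]addr0 flin// dual_ball0 addr0.
have aT1 : `|a *: T| <= 1.
  rewrite normrZ -of_real_modulus modulus_of_real//.
  have -> : `|T| = of_real (sup_norm T) by [].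
  rewrite -of_realM mulVf//.
  by have -> : 1 = of_real 1 :> scalars R k by case: (k).
have : ((modulus (f (a *: T)))%:E <= 1)%E.
  by case: Hf => _; apply: le_trans; apply: ereal_sup_ubound; exists (a *: T).
by rewrite lee_fin faT modulusM modulus_of_real// mulrC ler_pdivrMr// mul1r.
Qed.

Lemma modulus_sum (I : Type) (s : seq I) (z : I -> scalars R k) :
  modulus (\sum_(i <- s) z i) <= \sum_(i <- s) modulus (z i).
Proof.
elim: s => [|i s ih]; last first.
  by rewrite !big_cons (le_trans (modulusD _ _))// lerD2l.
by rewrite !big_nil modulus0.
Qed.

Lemma Cfun_sumE (I : Type) (s : seq I) (a : I -> scalars R k) (g : I -> CG)
    (x : G) :
  (\sum_(i <- s) a i *: g i : CG) x = \sum_(i <- s) a i * g i x.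
Proof.
elim: s => [|i s ih]; first by rewrite !big_nil.
by rewrite !big_cons -ih.
Qed.

(* Testing f on the sum of the a_i g_i with a_i = |f g_i|^p / f g_i and
   applying Young's inequality pointwise gives
   A <= B / p + (1 - 1/p) A for A the sum of the |f g_i|^p. *)
Lemma dual_ball_sum_powR (p B : R) (I : Type) (s : seq I) (g : I -> CG) :
  1 <= p -> (forall i, H (g i)) ->
  (forall x, \sum_(i <- s) modulus (g i x) `^ p <= B) ->
  \sum_(i <- s) modulus (f (g i)) `^ p <= B.
Proof.
move=> p1 Hg gB; have p0 : 0 < p by rewrite (lt_le_trans _ p1).
set A := leLHS.
(* If [f (g i)] vanishes, division by zero gives [a i] = 0, and [a_f] still holds because 0^p =
   0. *)
pose a i : scalars R k := of_real (modulus (f (g i)) `^ p) / f (g i).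
have a_f i : a i * f (g i) = of_real (modulus (f (g i)) `^ p).
  rewrite /a; have [->|fn0] := eqVneq (f (g i)) 0; last by rewrite divfK.
  by rewrite modulus0 powR0 ?gt_eqF// mulr0 of_real0.
(* Only an inequality: for p = 1 and [f (g i)] = 0 the left side is 0, while the right side is 0^0 =
   1. *)
have modulus_a i : modulus (a i) <= modulus (f (g i)) `^ (p - 1).
  have [m0|mn0] := eqVneq (modulus (f (g i))) 0.
    rewrite /a (modulus_eq0 m0) invr0 mulr0 modulus0.
    exact: powR_ge0.
  have m_gt0 : 0 < modulus (f (g i)) by rewrite lt_def mn0 modulus_ge0.
  rewrite -(ler_pM2r m_gt0) -modulusM a_f modulus_of_real ?powR_ge0//.
  by rewrite mulrC mulr_powRB1// modulus_ge0.
have fA : modulus (f (\sum_(i <- s) a i *: g i)) = A.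
  rewrite dual_ball_sum//; under eq_bigr do rewrite a_f.
  rewrite -(big_morph of_real (@of_realD R k) (@of_real0 R k)).
  by rewrite modulus_of_real// sumr_ge0// => i _; rewrite powR_ge0.
have pA_le : p * A <= B + (p - 1) * A.
  rewrite -{1}fA.
  rewrite mulrC -ler_pdivlMr//; apply: le_trans (dual_ball_le _) _.
    exact: subspace_sum.
  apply: sup_norm_le => x; rewrite ler_pdivlMr// mulrC Cfun_sumE.
  apply: le_trans (_ : p * \sum_(i <- s)
      (modulus (g i x) * modulus (f (g i)) `^ (p - 1)) <= _).
    rewrite ler_pM2l//; apply: le_trans (modulus_sum _ _) _.
    apply: ler_sum => i _; rewrite modulusM mulrC.
    by rewrite ler_wpM2l ?modulus_ge0.
  apply: le_trans (lerD (gB x) (lexx _)).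
  rewrite !mulr_sumr -big_split/=; apply: ler_sum => i _.
  by rewrite young_powR// modulus_ge0.
by move: pA_le; rewrite mulrBl mul1r addrCA -lerBlDl subrr subr_ge0.
Qed.

End dual_ball.

(** * Continuity and Borel measurability *)

(** Away from 0 the power is differentiable; at 0 the radius e^(1/p) works. The absolute value makes
    the function continuous on the whole line, so that it can be composed with [modulus]. *)
Lemma continuous_normr_powR (R : realType) (p : R) : 0 < p ->
  continuous (fun x : R => `|x| `^ p).
Proof.
move=> p0 x; have [->|xn0] := eqVneq x 0; last first.
  apply: (@continuous_comp _ _ _ (fun y : R => `|y|) (@powR R ^~ p)).
    exact: norm_continuous.
  apply: differentiable_continuous; rewrite -derivable1_diffP.
  by apply: derivable_powR; rewrite in_itv/= normr_gt0 xn0.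
have pn0 : p != 0 by rewrite gt_eqF.
apply/cvgrPdist_lt => e e0; rewrite normr0 powR0//.
near=> y; rewrite sub0r normrN ger0_norm ?powR_ge0//.
have -> : e = (e `^ p^-1) `^ p by rewrite -powRrM mulVf// powRr1// ltW.
rewrite gt0_ltr_powR// ?nnegrE ?powR_ge0//.
rewrite -[y]subr0 distrC; near: y.
by apply: cvgr_dist_lt; [exact: cvg_id|rewrite powR_gt0].
Unshelve. all: by end_near. Qed.

Lemma open_borel_measurable (G : compactGroupType) (U : set (borel G)) :
  open (U : set G) -> measurable U.
Proof. exact: sub_sigma_algebra. Qed.

Lemma continuous_borel_measurable (G : compactGroupType) (f : G -> G) :
  continuous f -> measurable_fun [set: borel G] (f : borel G -> borel G).
Proof.
move=> /continuousP fc.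
apply: (@measurability _ _ (borel G) (borel G) setT f (@open G) erefl).
move=> _ [U oU <-].
by rewrite setTI; apply: open_borel_measurable; exact: fc.
Qed.

Lemma continuous_real_measurable (R : realType) (G : compactGroupType)
    (f : G -> R) :
  continuous f -> measurable_fun [set: borel G] (f : borel G -> R).
Proof.
move=> /continuousP fc.
apply: (measurability _ (RGenOInfty.measurableE R)) => _ [_ [a ->] <-].
rewrite setTI; apply: open_borel_measurable.
by apply: fc; exact: interval_open.
Qed.

(** * Riemann sums with uniform error *)

(* Finite sums sum_i a_i F(t_i, x), a_i >= 0, are lists of pairs (a_i, t_i). *)
Lemma riemann_sum_cover d (T : measurableType d) (R : realType) (X : Type)
    (mu : {measure set T -> \bar R}) (F : T -> X -> R) (e : R)
    (U : T -> set T) (s : seq T) (B : set T) :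
  (mu setT < +oo)%E ->
  0 <= e ->
  (forall t x, 0 <= F t x) ->
  (forall x, measurable_fun [set: T] (F ^~ x)) ->
  (forall t, measurable (U t)) ->
  (forall t t', U t t' -> forall x, `|F t x - F t' x| <= e) ->
  measurable B ->
  (forall t, B t -> exists2 t', t' \in s & U t' t) ->
  exists l : seq ({nonneg R} * T), [/\
    (\sum_(w <- l) w.1%:num)%:E = mu B,
    forall x, ((\sum_(w <- l) w.1%:num * F w.2 x)%:E <=
               \int[mu]_(t in B) (F t x)%:E + e%:E * mu B)%E &
    forall x, (\int[mu]_(t in B) (F t x)%:E <=
               (\sum_(w <- l) w.1%:num * F w.2 x)%:E + e%:E * mu B)%E].
Proof.
(* Induction on the cover turns it into a partition: [U t] is cut off from [B], and the rest of the
   list covers what remains. *)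
move=> muT e0 F0 mF mU FU; elim: s B => [|t s ih] B mB Bs.
  have -> : B = set0 by rewrite -subset0 => t /Bs[].
  exists [::]; split=> [|x|x]; rewrite ?big_nil measure0//.
    by rewrite integral_set0 mule0 adde0.
  by rewrite integral_set0 mule0 adde0.
have mBU : measurable (B `&` U t) by exact: measurableI.
have mBD : measurable (B `\` U t) by exact: measurableD.
have [|l [lB lI Il]] := ih _ mBD.
  move=> y [/Bs[t']]; rewrite inE => /predU1P[->//|t's Uy _].
  by exists t'.
have muE A : measurable A -> mu A = (fine (mu A))%:E.
  move=> mA; rewrite fineK// ge0_fin_numE//.
  by rewrite (le_lt_trans _ muT)// le_measure ?inE.
have muB : mu B = (mu (B `&` U t) + mu (B `\` U t))%E.
  by rewrite addeC -measureDI.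
have intB x : (\int[mu]_(t in B) (F t x)%:E =
    \int[mu]_(t in B `&` U t) (F t x)%:E +
    \int[mu]_(t in B `\` U t) (F t x)%:E)%E.
  rewrite -ge0_integral_setU//.
  - by rewrite setUIDK.
  - by apply/measurable_EFinP; apply: measurable_funTS; exact: mF.
  - by move=> y _; rewrite lee_fin.
  - by rewrite disj_set2E; apply/eqP; rewrite setDE setIACA setICr setI0.
have mFB A x : measurable_fun A (fun y => (F y x)%:E).
  by apply/measurable_EFinP; apply: measurable_funTS; exact: mF.
have mFeB A x : measurable_fun A (fun y => (F y x + e)%:E).
  apply/measurable_EFinP; apply: measurable_funD => //.
  by apply: measurable_funTS; exact: mF.
have intcst A (a : R) : measurable A ->
    (\int[mu]_(_ in A) a%:E = a%:E * mu A)%E.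
  by move=> mA; rewrite -(integral_cst mu mA).
have muBU0 : 0 <= fine (mu (B `&` U t)) by rewrite fine_ge0.
(* The node is [t], which need not lie in [B]; its weight is the mass of the piece [B] ∩ [U t]. On
   that piece [F t x] and [F y x] differ by at most e, and integrating over y gives both bounds. *)
exists ((NngNum muBU0, t) :: l); split.
- by rewrite big_cons EFinD lB muB /= -muE.
- move=> x; rewrite big_cons/= intB muB EFinD EFinM -muE//.
  rewrite muleDr ?ge0_adde_def ?inE//.
  rewrite addeACA leeD//.
  rewrite muleC -intcst// -intcst// -ge0_integralD//.
  + apply: ge0_le_integral => //.
    * by move=> y _; rewrite lee_fin.
    * exact: mFeB.
    * move=> y [_ /FU/(_ x)]; rewrite -EFinD lee_fin ler_norml => /andP[_].
      by rewrite lerBlDl.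
  + by move=> y _; rewrite lee_fin.
- move=> x; rewrite big_cons/= intB muB EFinD EFinM -muE//.
  rewrite muleDr ?ge0_adde_def ?inE//.
  rewrite [leRHS]addeACA leeD//.
  rewrite [X in (_ <= X + _)%E]muleC -intcst// -intcst// -ge0_integralD//.
  + apply: ge0_le_integral => //.
    * by move=> y _; rewrite lee_fin.
    * move=> y [_ /FU/(_ x)]; rewrite -EFinD lee_fin ler_norml => /andP[+ _].
      by rewrite lerNl opprB lerBlDl.
  + by move=> y _; rewrite lee_fin.
Qed.

(** A tube lemma: joint continuity gives the bound on a product neighbourhood of each (y, x), and
    compactness of [K] leaves one neighbourhood of y that serves all x. *)
Lemma near_compact_uniform (R : realType) (X K : topologicalType)
    (F : X * K -> R) (e : R) (y : X) :
  compact [set: K] -> continuous F -> 0 < e ->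
  \forall y' \near y, forall x, `|F (y, x) - F (y', x)| <= e.
Proof.
move=> /compact_near_coveringP Kc Fc e0.
have e20 : 0 < e / 2 by rewrite divr_gt0.
have near_F (x : K) : \forall x' \near x & y' \near y,
    `|F (y, x') - F (y', x')| <= e.
  have /cvgrPdist_lt/(_ _ e20) := Fc (y, x).
  case=> -[A B]/= [Ay Bx] AB; exists (B, A) => //= -[x' y']/= [Bx' Ay'].
  have := AB (y, x') (conj (nbhs_singleton Ay) Bx').
  have := AB (y', x') (conj Ay' Bx').
  rewrite /= distrC => h1 h2.
  (* Both values are compared with F (y, x), at a cost of e / 2 each. *)
  rewrite (splitr e) -(subrK (F (y, x)) (F (y, x'))) -addrA.
  rewrite (le_trans (ler_normD _ _))// lerD// ltW//; first by rewrite distrC.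
  by rewrite distrC.
have := Kc _ (nbhs y) (fun y' x => `|F (y, x) - F (y', x)| <= e) _
  (fun x _ => near_F x).
by move=> /(_ (nbhs_filter y)); apply: filterS => y' h x; exact: h.
Qed.

(** * Invariant integration and Riemann sums for Haar measure *)

Section haar.
Context {R : realType} {G : compactGroupType}.
Variable sigma : {measure set (borel G) -> \bar R}.
Hypothesis sigma_haar : normalized_haar_measure sigma.

Lemma haar_setT : sigma [set: borel G] = 1%E.
Proof. by case: sigma_haar => -[]. Qed.

Lemma integral_left_translation (psi : G) (f : borel G -> \bar R) :
  measurable_fun setT f -> (forall x, 0 <= f x)%E ->
  (\int[sigma]_x f (left_translation psi x) = \int[sigma]_x f x)%E.
Proof.
move=> mf f0.
have mpsi : measurable_fun [set: borel G]
    (left_translation psi : borel G -> borel G).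
  apply: continuous_borel_measurable.
  exact: (@left_translation_continuous G psi).
have := ge0_integral_pushforward mpsi sigma measurableT mf (fun y _ => f0 y).
rewrite preimage_setT => <-.
apply: eq_measure_integral => A mA _; rewrite /pushforward.
(* Invariance is stated for images of translations; the preimage of [A] under translation by psi is
   its image under translation by psi^-1. *)
case: sigma_haar => _ /(_ psi^-1%g A mA) <-; congr (sigma _).
apply/seteqP; split => [x Ax|_ [x Ax <-]].
  by exists (psi * x)%g => //; rewrite /left_translation mulKg.
by rewrite /preimage/= /left_translation mulVKg.
Qed.

(* The function F y x = h (y^-1 x) has, for every x, the same integral c in y:
   substitute y -> x y. Hence its Riemann sums, which are combinations of left
   translates of h, are uniformly close to c, and integrating them in x
   identifies c with the integral of h. *)
Lemma haar_riemann_sum (h : G -> R) (e : R) :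
  continuous h -> (forall x, 0 <= h x) -> 0 < e ->
  exists l : seq ({nonneg R} * G),
    \sum_(w <- l) w.1%:num = 1 /\
    forall x, ((\sum_(w <- l) w.1%:num * h (w.2 * x)%g)%:E <=
               \int[sigma]_y (h y)%:E + e%:E)%E.
Proof.
(* One half of e pays for the Riemann sum, the other for comparing c with the integral of h. *)
move=> hc h0 e0; have e20 : 0 < e / 2 by rewrite divr_gt0.
pose F (z : G * G) := h (z.1^-1 * z.2)%g.
have Fc : continuous F.
  move=> z; apply: continuous_comp; last exact: hc.
  apply: (@continuous_comp _ _ _ (fun z : G * G => (z.1^-1%g, z.2))
    (fun z : G * G => (z.1 * z.2)%g)); last exact: mulg_continuous.
  apply: cvg_pair => /=; last exact: cvg_snd.
  apply: (@continuous_comp _ _ _ (@fst G G) (fun x : G => x^-1%g)).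
    exact: cvg_fst.
  exact: invg_continuous.
(* Taking the interior makes [U y] open, hence Borel and usable in a cover; uniformity in x keeps y
   inside it. *)
pose U (y : G) :=
  interior [set y' | forall x, `|F (y, x) - F (y', x)| <= e / 2].
have oU y : open (U y) by exact: open_interior.
have Uy y : U y y.
  exact: (near_compact_uniform y (@compact_setT G) Fc e20).
have [s _ sG] : finite_subset_cover [set: G] U [set: G].
  have := @compact_setT G; rewrite compact_cover; apply=> // y _.
  by exists y.
have mF x : measurable_fun [set: borel G] (fun y : borel G => F (y, x)).
  apply: continuous_real_measurable => y.
  apply: (@continuous_comp _ _ _ (fun y : G => (y, x)) F); last exact: Fc.
  by apply: cvg_pair => /=; [exact: cvg_id|exact: cvg_cst].
have mh : measurable_fun [set: borel G] (h : borel G -> R).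
  exact: continuous_real_measurable.
have sigma_fin : (sigma setT < +oo)%E by rewrite haar_setT ltry.
have mU y : measurable (U y : set (borel G)) by exact: open_borel_measurable.
have FU y y' : U y y' -> forall x, `|F (y, x) - F (y', x)| <= e / 2.
  by move=> /interior_subset.
have cover_s y : [set: G] y -> exists2 y', y' \in finmap.enum_fset s & U y' y.
  by move=> _; have [y' ys Uyy'] := sG y I; exists y'.
have [l [l1 lI Il]] := @riemann_sum_cover _ (borel G) R G sigma
  (fun y x => F (y, x)) (e / 2) U (finmap.enum_fset s) setT sigma_fin (ltW e20)
  (fun _ _ => h0 _) mF mU FU measurableT cover_s.
rewrite haar_setT in l1.
have {l1}l1 : \sum_(w <- l) w.1%:num = 1 by case: l1.
have mF_left y : measurable_fun [set: borel G] (fun x : borel G => F (y, x)).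
  apply: continuous_real_measurable => x.
  apply: (@continuous_comp _ _ _ (fun x : G => (y, x)) F); last exact: Fc.
  by apply: cvg_pair => /=; [exact: cvg_cst|exact: cvg_id].
pose c := (\int[sigma]_y (h y^-1%g)%:E)%E.
have mhV : measurable_fun [set: borel G] (fun y : borel G => h y^-1%g).
  apply: continuous_real_measurable => y.
  apply: (@continuous_comp _ _ _ (fun x : G => x^-1%g) h); last exact: hc.
  exact: invg_continuous.
(* Invariance under x^-1, applied to y |-> h (y^-1), since (x^-1 y)^-1 = y^-1 x. *)
have Fint x : (\int[sigma]_y (F (y, x))%:E = c)%E.
  rewrite /c -[RHS](integral_left_translation x^-1%g); last 2 first.
  - by apply/measurable_EFinP; exact: mhV.
  - by move=> y; rewrite lee_fin.
  by apply: eq_integral => y _; rewrite /left_translation invgM invgK.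
exists [seq (w.1, w.2^-1%g) | w <- l]; split.
  by rewrite big_map.
(* As [sigma] has mass 1, c is the integral over x of the constant c. The lower Riemann bound [Il]
   is integrated in x; each left translate of h integrates to the integral of h, and the weights add
   up to 1. *)
have c_le : (c <= \int[sigma]_y (h y)%:E + (e / 2)%:E)%E.
  have -> : c = (\int[sigma]_x cst c x)%E.
    by rewrite integral_cst// haar_setT mule1.
  pose g (w : {nonneg R} * G) (x : borel G) :=
    (w.1%:num%:E * (h (left_translation w.2^-1%g x))%:E)%E.
  have mhw (w : {nonneg R} * G) : measurable_fun [set: borel G]
      (fun x : borel G => (h (left_translation w.2^-1%g x))%:E).
    apply/measurable_EFinP; exact: (mF_left w.2).
  have mg w : measurable_fun [set: borel G] (g w).
    by apply: measurable_funeM; exact: mhw.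
  have g0 w x : (0 <= g w x)%E by rewrite mule_ge0// lee_fin.
  have int_g w : (\int[sigma]_x g w x =
      w.1%:num%:E * \int[sigma]_x (h x)%:E)%E.
    rewrite ge0_integralZl//; last by move=> x _; rewrite lee_fin.
    congr (_ * _)%E.
    apply: (integral_left_translation w.2^-1%g (f := fun x => (h x)%:E)) => //.
    exact/measurable_EFinP.
  have -> : (\int[sigma]_y (h y)%:E + (e / 2)%:E =
      \int[sigma]_x (\sum_(w <- l) g w x + cst (e / 2)%:E x))%E.
    rewrite ge0_integralD//; last 3 first.
    - by move=> x _; exact: sume_ge0.
    - exact: emeasurable_sum.
    - by move=> x _; rewrite lee_fin ltW.
    rewrite integral_cst// haar_setT mule1 ge0_integral_sum//; congr (_ + _)%E.
    under [RHS]eq_bigr do rewrite int_g.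
    by rewrite -ge0_sume_distrl ?sumEFin ?l1 ?mul1e.
  apply: (@ge0_le_integral _ (borel G) R sigma setT measurableT (cst c)
    (fun x => \sum_(w <- l) g w x + cst (e / 2)%:E x)%E) => //.
  - by move=> x _; apply: integral_ge0 => y _; rewrite lee_fin.
  - by apply: emeasurable_funD => //; exact: emeasurable_sum.
  - move=> x _; rewrite -[X in (X <= _)%E](Fint x); apply: le_trans (Il x) _.
    rewrite haar_setT mule1 leeD// -sumEFin; apply: lee_sum => w _.
    by rewrite EFinM.
move=> x; rewrite big_map/=; apply: le_trans (lI x) _.
by rewrite Fint haar_setT mule1 [in leRHS](splitr e) EFinD addeA leeD.
Qed.

End haar.

(** * Replacing real weights by repetitions *)

(** Each node of weight a is repeated floor(N a) times. Rounding down can only decrease the sums of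
    the nonnegative h, and it loses less than one repetition per node, hence the error [size l],
    independent of N. *)
Lemma weights_to_multiplicities (R : realType) (X Y : Type)
    (l : seq ({nonneg R} * Y)) (h : Y -> X -> R) (N : nat) :
  (forall y x, 0 <= h y x) ->
  exists s : seq Y,
    N%:R * (\sum_(w <- l) w.1%:num) - (size l)%:R <= (size s)%:R /\
    forall x, \sum_(y <- s) h y x <= N%:R * \sum_(w <- l) w.1%:num * h w.2 x.
Proof.
move=> h0; elim: l => [|[a y] l [s [sl sh]]].
  by exists [::]; split=> [|x]; rewrite !big_nil mulr0// subr0.
have Na0 : 0 <= N%:R * a%:num by rewrite mulr_ge0.
pose m := Num.truncn (N%:R * a%:num).
exists (nseq m y ++ s); split=> [|x].
  rewrite big_cons/= size_cat size_nseq natrD mulrDr.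
  have /ltW := truncnS_gt (N%:R * a%:num); rewrite -natr1 => am.
  by move: sl am; rewrite -/m -(natr1 (size l)); lra.
rewrite big_cat big_cons/= mulrDr lerD// big_nseq.
rewrite iter_addr_0 mulrA -[leLHS]mulr_natl ler_wpM2r//.
by rewrite truncn_le.
Qed.

(** Divide by N and let N tend to infinity. Concretely, if b < a, any N > m a / (a - b) contradicts
    the hypothesis. *)
Lemma ler_of_natr_mul (R : archiRealFieldType) (a b m : R) :
  (forall N : nat, (N%:R - m) * a <= N%:R * b) -> a <= b.
Proof.
move=> ab; rewrite leNgt; apply/negP => ba.
have ab0 : 0 < a - b by rewrite subr_gt0.
have := ab (Num.truncn (m * a / (a - b))).+1.
have := truncnS_gt (m * a / (a - b)).
rewrite ltr_pdivrMr//; move: (_.+1%:R) => N; lra.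
Qed.

(** * The summing inequality on translates and its limit *)

Section translation.
Context {R : realType} {k : scalar_kind} {G : compactGroupType}.
Local Notation CG := (Cfun R k G).
Context {H : set CG} {Y : metricType R} {u : CG -> Y} {p C : R}.
Hypotheses (H_subspace : subspace_of_Cfun H)
  (H_translation : translation_invariant_set H)
  (u_translation : translation_invariant_map H u) (p1 : 1 <= p) (C0 : 0 < C).
Hypothesis u_summing : forall (n : nat) (x q : 'I_n -> CG),
  (forall j, H (x j)) -> (forall j, H (q j)) ->
  (((\sum_(j < n) mdist (u (x j)) (u (q j)) `^ p) `^ p^-1)%:E <=
   C%:E * ereal_sup
     [set ((\sum_(j < n) modulus (f (x j) - f (q j)) `^ p) `^ p^-1)%:E
       | f in dual_ball H])%E.
Context {T S : CG}.
Hypotheses (HT : H T) (HS : H S).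

(** Invariance of [u] makes all terms on the left of the summing inequality equal. On the right,
    [dual_ball_sum_powR] applied to the differences of translates reduces the supremum over
    functionals to a bound at the points of [G]. *)
Lemma summing_translates (s : seq G) (B : R) :
  (forall x, \sum_(psi <- s) modulus (T (psi * x)%g - S (psi * x)%g) `^ p
    <= B) ->
  (size s)%:R * mdist (u T) (u S) `^ p <= C `^ p * B.
Proof.
move=> sB; have p0 : 0 < p by rewrite (lt_le_trans _ p1).
pose tr (Q : CG) (j : 'I_(size s)) := translate (tnth (in_tuple s) j) Q.
have B0 : 0 <= B.
  by apply: le_trans (sB point); rewrite sumr_ge0// => j _; rewrite powR_ge0.
have Htr Q : H Q -> forall j, H (tr Q j) by move=> HQ j; exact: H_translation.
have Htr_sub j : H (tr T j - tr S j).
  by rewrite addrC -scaleN1r; apply H_subspace; exact: Htr.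
have dual_le f : dual_ball H f ->
    \sum_j modulus (f (tr T j) - f (tr S j)) `^ p <= B.
  move=> Hf; have f_sub j : f (tr T j) - f (tr S j) = f (tr T j - tr S j).
    rewrite [in RHS]addrC -[in RHS]scaleN1r; case: Hf => -[flin _] _.
    by rewrite flin ?mulN1r 1?addrC//; exact: Htr.
  under eq_bigr do rewrite f_sub.
  apply: (dual_ball_sum_powR H_subspace Hf p1 Htr_sub) => x.
  by apply: le_trans (sB x); rewrite [leRHS]big_tnth.
have := u_summing (Htr T HT) (Htr S HS).
under eq_bigr do rewrite !u_translation//.
rewrite sumr_const card_ord -[_ *+ _]mulr_natl => sum_le.
have {sum_le} : ((size s)%:R * mdist (u T) (u S) `^ p) `^ p^-1 <= C * B `^ p^-1.
  rewrite -lee_fin; apply: le_trans sum_le _.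
  rewrite EFinM lee_pmul2l//; apply: ge_ereal_sup => _ [f Hf <-].
  rewrite lee_fin ge0_ler_powR ?invr_ge0 ?(ltW p0)// ?nnegrE//.
    by rewrite sumr_ge0// => j _; rewrite powR_ge0.
  exact: dual_le.
(* Raising to the power p removes the outer roots on both sides. *)
move=> /(ge0_ler_powR (ltW p0)); rewrite !nnegrE !powR_ge0.
rewrite mulr_ge0 ?powR_ge0 ?(ltW C0)// => /(_ isT isT).
rewrite [leRHS]powRM ?powR_ge0 ?(ltW C0)// -!powRrM mulVf ?gt_eqF// !powRr1//.
by rewrite mulr_ge0 ?powR_ge0.
Qed.

Lemma summing_haar (sigma : {measure set (borel G) -> \bar R}) :
  normalized_haar_measure sigma ->
  ((mdist (u T) (u S))%:E <= C%:E *
    (\int[sigma]_phi (modulus (T phi - S phi) `^ p)%:E) `^ p^-1)%E.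
Proof.
move=> sigma_haar; have p0 : 0 < p by rewrite (lt_le_trans _ p1).
pose h x := modulus (T x - S x) `^ p.
have h0 x : 0 <= h x by exact: powR_ge0.
have hc : continuous h.
  have -> : h = (fun y : R => `|y| `^ p) \o (fun x => modulus (T x - S x)).
    by apply/funext => x; rewrite /h/= ger0_norm ?modulus_ge0.
  move=> x; apply: (@continuous_comp G R R (fun x => modulus (T x - S x))
    (fun y : R => `|y| `^ p)); last exact: continuous_normr_powR.
  apply: (@continuous_comp G _ R (T - S : CG) (@modulus R k)).
    exact: Cfun_continuous.
  exact: modulus_continuous.
have : (0 <= \int[sigma]_x (h x)%:E)%E.
  by apply: integral_ge0 => x _; rewrite lee_fin.
have riemann := haar_riemann_sum sigma_haar hc h0.
move: riemann; rewrite -/h.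
(* An infinite integral makes the right side infinite because C > 0; the value -oo is excluded by
   nonnegativity. *)
case: (\int[sigma]_x (h x)%:E)%E => [I| |//] riemann I0; last first.
  by rewrite poweRyr ?invr_eq0 ?gt_eqF// gt0_muley ?lte_fin// leey.
rewrite lee_fin in I0; rewrite poweR_EFin -EFinM lee_fin.
have d_le : mdist (u T) (u S) `^ p <= C `^ p * I.
  apply/ler_addgt0Pr => e e0.
  (* The accuracy e / C^p becomes e after multiplication by C^p. *)
  have [l [l1 lI]] := riemann _ (divr_gt0 e0 (powR_gt0 p C0)).
  (* For fixed e, the number N of repetitions tends to infinity, which absorbs the rounding loss
     [size l]. *)
  apply: (@ler_of_natr_mul _ _ _ (size l)%:R) => N.
  have [s []] := weights_to_multiplicities l N (fun y x => h0 (y * x)%g).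
  rewrite l1 mulr1 => Ns sI.
  apply: le_trans (_ : (size s)%:R * mdist (u T) (u S) `^ p <= _).
    by rewrite ler_wpM2r ?powR_ge0.
  apply: le_trans (summing_translates (B := N%:R * (I + e / C `^ p)) _) _.
    move=> x; apply: le_trans (sI x) _; rewrite ler_wpM2l//.
    by have := lI x; rewrite -EFinD lee_fin.
  by rewrite mulrCA mulrDr [C `^ p * (e / _)]mulrC divfK// gt_eqF// powR_gt0.
have -> : mdist (u T) (u S) = (mdist (u T) (u S) `^ p) `^ p^-1.
  by rewrite -powRrM mulfV ?gt_eqF// powRr1// mdist_ge0.
have -> : C * I `^ p^-1 = (C `^ p * I) `^ p^-1.
  rewrite powRM ?powR_ge0// -powRrM mulfV ?gt_eqF// powRr1//.
  exact: ltW.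
rewrite ge0_ler_powR ?invr_ge0 ?(ltW p0)// nnegrE ?powR_ge0//.
by rewrite mulr_ge0 ?powR_ge0.
Qed.

End translation.

Theorem theorem4p3 (R : realType) (k : scalar_kind) (G : compactGroupType)
    (H : set (Cfun R k G)) (Y : metricType R) (p : R) (u : Cfun R k G -> Y)
    (sigma : {measure set (borel G) -> \bar R}) :
  subspace_of_Cfun H ->
  closed H ->
  translation_invariant_set H ->
  1 <= p ->
  lipschitz_summing p H u ->
  translation_invariant_map H u ->
  normalized_haar_measure sigma ->
  pietsch_measure p H u sigma.
Proof.
move=> H_subspace _ H_translation p1 [_ [C C0 u_summing]] u_translation.
move=> sigma_haar; split; first by case: sigma_haar.
(* The summing constant itself serves as the Pietsch constant. *)
exists C => // T S HT HS.
exact: (summing_haar H_subspace H_translation u_translation p1 C0 u_summing).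
Qed.
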